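(* Let $G$ and $H$ be two finite abelian groups and let $K$ be an integral domain of characteristic zero. If the partial group algebras $K_{\mathrm{par}}(G)$ and $K_{\mathrm{par}}(H)$ are isomorphic as $K$-algebras, then $G$ and $H$ are isomorphic groups.
   Context: For a finite group $G$ with identity $e$ and a (commutative) integral domain $K$, the partial group algebra $K_{\mathrm{par}}(G)$ is the universal associative $K$-algebra with unit $1$ generated by the set of symbols $\{[g] : g\in G\}$ subject to the relations (1) $[e]=1$; (2) $[s^{-1}][s][t]=[s^{-1}][st]$; (3) $[s][t][t^{-1}]=[st][t^{-1}]$, for all $s,t\in G$. *)

(* Defs.v *)
From HB Require Import structures.
From mathcomp Require Import all_boot all_order all_algebra all_fingroup.
From mathcomp Require Import generic_quotient boolp.

Set Implicit Arguments.
Unset Strict Implicit.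
Unset Printing Implicit Defensive.

Import GRing.Theory.

Local Open Scope ring_scope.
Local Open Scope quotient_scope.

Definition partial_rep (G : finGroupType) (A : nzRingType) (f : G -> A) :=
  [/\ f 1%g = 1,
      forall s t : G, f (s^-1)%g * f s * f t = f (s^-1)%g * f (s * t)%g &
      forall s t : G, f s * f t * f (t^-1)%g = f (s * t)%g * f (t^-1)%g].

Section PartialGroupAlgebra.
Variables (K : idomainType) (G : finGroupType).

(* The partial group algebra is presented by generators and relations:
   expressions built from the symbols [g] and the constants of K, modulo the
   least congruence par_eq containing the laws of unital associative
   K-algebras and the three defining relations.  The theorem
   par_alg_universal below is its universal property. *)
Inductive par_term : Type :=
| Gen of G
| Cst of K
| Add of par_term & par_term
| Mul of par_term & par_term.

Local Notation "''[' g ]" := (Gen g) (at level 0, format "''[' g ]").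
Local Notation "x +' y" := (Add x y) (at level 50, left associativity).
Local Notation "x *' y" := (Mul x y) (at level 40, left associativity).
Local Notation "0'" := (Cst 0) (at level 0).
Local Notation "1'" := (Cst 1) (at level 0).

Reserved Notation "x =' y" (at level 70, no associativity).

Inductive par_eq : par_term -> par_term -> Prop :=
| EqRefl x : x =' x
| EqSym x y : x =' y -> y =' x
| EqTrans x y z : x =' y -> y =' z -> x =' z
| EqAdd x x' y y' : x =' x' -> y =' y' -> x +' y =' x' +' y'
| EqMul x x' y y' : x =' x' -> y =' y' -> x *' y =' x' *' y'
| EqAddA x y z : x +' (y +' z) =' x +' y +' z
| EqAddC x y : x +' y =' y +' x
| EqAdd0 x : 0' +' x =' x
| EqAddN x : Cst (-1) *' x +' x =' 0'
| EqMulA x y z : x *' (y *' z) =' x *' y *' z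
| EqMul1l x : 1' *' x =' x
| EqMul1r x : x *' 1' =' x
| EqMulDl x y z : (x +' y) *' z =' x *' z +' y *' z
| EqMulDr x y z : x *' (y +' z) =' x *' y +' x *' z
| EqCstD a b : Cst (a + b) =' Cst a +' Cst b
| EqCstM a b : Cst (a * b) =' Cst a *' Cst b
| EqCstC a x : Cst a *' x =' x *' Cst a
| EqRel1 : '[1%g] =' 1'
| EqRel2 (s t : G) :
    '[(s^-1)%g] *' '[s] *' '[t] =' '[(s^-1)%g] *' '[(s * t)%g]
| EqRel3 (s t : G) :
    '[s] *' '[t] *' '[(t^-1)%g] =' '[(s * t)%g] *' '[(t^-1)%g]
where "x =' y" := (par_eq x y).

HB.instance Definition _ := gen_eqMixin par_term.
HB.instance Definition _ := gen_choiceMixin par_term.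

Definition par_eqb (x y : par_term) : bool := `[< par_eq x y >].

Lemma par_eqb_equiv : equiv_class_of par_eqb.
Proof.
split=> [x|x y|y x z].
- by apply/asboolP/EqRefl.
- by apply/asboolP/asboolP; exact: EqSym.
- by move=> /asboolP xy /asboolP yz; apply/asboolP/(EqTrans xy yz).
Qed.

Canonical par_eqb_equiv_rel := EquivRelPack par_eqb_equiv.
Canonical par_eqb_encModRel := defaultEncModRel par_eqb.

Definition par_alg : Type := {eq_quot par_eqb}.

HB.instance Definition _ := Choice.on par_alg.

Definition par_pi (x : par_term) : par_alg := \pi_{eq_quot par_eqb} x.
Definition par_repr (u : par_alg) : par_term := repr u.

Lemma par_reprK : cancel par_repr par_pi.
Proof. by move=> u; exact: reprK. Qed.

Lemma par_piP x y : par_pi x = par_pi y <-> par_eq x y.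
Proof.
split=> [/eqmodP/asboolP //|xy].
by apply/eqmodP/asboolP.
Qed.

Lemma par_repr_pi x : par_eq (par_repr (par_pi x)) x.
Proof. by apply/par_piP; rewrite par_reprK. Qed.

Definition par_zero : par_alg := par_pi 0'.
Definition par_one : par_alg := par_pi 1'.
Definition par_add (u v : par_alg) : par_alg := par_pi (par_repr u +' par_repr v).
Definition par_mul (u v : par_alg) : par_alg := par_pi (par_repr u *' par_repr v).
Definition par_scale (c : K) (u : par_alg) : par_alg :=
  par_pi (Cst c *' par_repr u).
Definition par_opp (u : par_alg) : par_alg := par_scale (-1) u.

Lemma par_piD x y : par_pi (x +' y) = par_add (par_pi x) (par_pi y).
Proof. by apply/esym/par_piP/EqAdd; exact: par_repr_pi. Qed.

Lemma par_piM x y : par_pi (x *' y) = par_mul (par_pi x) (par_pi y).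
Proof. by apply/esym/par_piP/EqMul; exact: par_repr_pi. Qed.

Lemma par_piZ c x : par_pi (Cst c *' x) = par_scale c (par_pi x).
Proof. by apply/esym/par_piP/EqMul; [exact: EqRefl | exact: par_repr_pi]. Qed.

Lemma par_alg_quot_ind (P : par_alg -> Prop) :
  (forall x, P (par_pi x)) -> forall u, P u.
Proof. by move=> Ppi u; rewrite -[u]par_reprK. Qed.

Lemma par_addA : associative par_add.
Proof.
elim/par_alg_quot_ind=> x; elim/par_alg_quot_ind=> y.
elim/par_alg_quot_ind=> z; rewrite -!par_piD; apply/par_piP; exact: EqAddA.
Qed.

Lemma par_addC : commutative par_add.
Proof.
elim/par_alg_quot_ind=> x; elim/par_alg_quot_ind=> y.
rewrite -!par_piD; apply/par_piP; exact: EqAddC.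
Qed.

Lemma par_add0 : left_id par_zero par_add.
Proof.
elim/par_alg_quot_ind=> x; rewrite -par_piD; apply/par_piP; exact: EqAdd0.
Qed.

Lemma par_addN : left_inverse par_zero par_opp par_add.
Proof.
elim/par_alg_quot_ind=> x; rewrite /par_opp -par_piZ -par_piD.
by apply/par_piP; exact: EqAddN.
Qed.

HB.instance Definition _ :=
  GRing.isZmodule.Build par_alg par_addA par_addC par_add0 par_addN.

Lemma par_mulA : associative par_mul.
Proof.
elim/par_alg_quot_ind=> x; elim/par_alg_quot_ind=> y.
elim/par_alg_quot_ind=> z; rewrite -!par_piM; apply/par_piP; exact: EqMulA.
Qed.

Lemma par_mul1l : left_id par_one par_mul.
Proof.
elim/par_alg_quot_ind=> x; rewrite -par_piM; apply/par_piP; exact: EqMul1l.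
Qed.

Lemma par_mul1r : right_id par_one par_mul.
Proof.
elim/par_alg_quot_ind=> x; rewrite -par_piM; apply/par_piP; exact: EqMul1r.
Qed.

Lemma par_mulDl : left_distributive par_mul par_add.
Proof.
elim/par_alg_quot_ind=> x; elim/par_alg_quot_ind=> y.
elim/par_alg_quot_ind=> z; rewrite -!(par_piM, par_piD).
by apply/par_piP; exact: EqMulDl.
Qed.

Lemma par_mulDr : right_distributive par_mul par_add.
Proof.
elim/par_alg_quot_ind=> x; elim/par_alg_quot_ind=> y.
elim/par_alg_quot_ind=> z; rewrite -!(par_piM, par_piD).
by apply/par_piP; exact: EqMulDr.
Qed.

Fixpoint par_eval (A : algType K) (f : G -> A) (x : par_term) : A :=
  match x with
  | '[g] => f g
  | Cst c => c%:A
  | y +' z => par_eval f y + par_eval f z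
  | y *' z => par_eval f y * par_eval f z
  end.

Lemma par_evalE (A : algType K) (f : G -> A) x y :
  partial_rep f -> par_eq x y -> par_eval f x = par_eval f y.
Proof.
case=> f1 fl fr; elim=> //=.
- by move=> ? ? ? _ -> _ ->.
- by move=> ? ? ? ? _ -> _ ->.
- by move=> ? ? ? ? _ -> _ ->.
- by move=> *; rewrite addrA.
- by move=> *; rewrite addrC.
- by move=> *; rewrite scale0r add0r.
- by move=> *; rewrite scaleN1r mulN1r addNr scale0r.
- by move=> *; rewrite mulrA.
- by move=> *; rewrite scale1r mul1r.
- by move=> *; rewrite scale1r mulr1.
- by move=> *; rewrite mulrDl.
- by move=> *; rewrite mulrDr.
- by move=> *; rewrite scalerDl.
- by move=> *; rewrite -scalerAl mul1r scalerA.
- by move=> *; rewrite -scalerAl -scalerAr mul1r mulr1.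
- by rewrite scale1r.
Qed.

Lemma par_one_neq0 : par_one != 0.
Proof.
have rep1 : @partial_rep G K^o (fun=> 1) by split=> *; rewrite ?mulr1.
apply/eqP=> /par_piP/(par_evalE rep1)/eqP.
by rewrite /= scale1r scale0r oner_eq0.
Qed.

HB.instance Definition _ := GRing.Zmodule_isNzRing.Build par_alg
  par_mulA par_mul1l par_mul1r par_mulDl par_mulDr par_one_neq0.

Lemma par_scaleE c u : par_scale c u = par_pi (Cst c) * u.
Proof. by elim/par_alg_quot_ind: u => x; rewrite -par_piZ par_piM. Qed.

Lemma par_piCD a b : par_pi (Cst (a + b)) = par_pi (Cst a) + par_pi (Cst b).
Proof. by rewrite -[RHS]par_piD; apply/par_piP; exact: EqCstD. Qed.

Lemma par_piCM a b : par_pi (Cst (a * b)) = par_pi (Cst a) * par_pi (Cst b).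
Proof. by rewrite -[RHS]par_piM; apply/par_piP; exact: EqCstM. Qed.

Lemma par_piCC a u : par_pi (Cst a) * u = u * par_pi (Cst a).
Proof.
elim/par_alg_quot_ind: u => x; rewrite -[LHS]par_piM -[RHS]par_piM.
by apply/par_piP; exact: EqCstC.
Qed.

Lemma par_scaleA (a b : K) (u : par_alg) :
  par_scale a (par_scale b u) = par_scale (a * b) u.
Proof. by rewrite !par_scaleE mulrA par_piCM. Qed.

Lemma par_scale1 : left_id 1 par_scale.
Proof. by move=> u; rewrite par_scaleE [LHS]mul1r. Qed.

Lemma par_scaleDr : right_distributive par_scale +%R.
Proof. by move=> a u v; rewrite !par_scaleE mulrDr. Qed.

Lemma par_scaleDl (u : par_alg) : {morph par_scale^~ u : a b / a + b}.
Proof. by move=> a b; rewrite !par_scaleE par_piCD mulrDl. Qed.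

HB.instance Definition _ := GRing.Zmodule_isLmodule.Build K par_alg
  par_scaleA par_scale1 par_scaleDr par_scaleDl.

Lemma par_scaleAl (a : K) (u v : par_alg) : a *: (u * v) = (a *: u) * v.
Proof. by rewrite [LHS]par_scaleE [a *: u]par_scaleE mulrA. Qed.

HB.instance Definition _ :=
  GRing.Lmodule_isLalgebra.Build K par_alg par_scaleAl.

Lemma par_scaleAr (a : K) (u v : par_alg) : a *: (u * v) = u * (a *: v).
Proof.
by rewrite [LHS]par_scaleE [a *: v]par_scaleE mulrA par_piCC -mulrA par_piCC.
Qed.

HB.instance Definition _ := GRing.Lalgebra_isAlgebra.Build K par_alg par_scaleAr.

Definition par_gen (g : G) : par_alg := par_pi '[g].

Lemma par_gen_rep : partial_rep par_gen.
Proof.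
split=> [|s t|s t].
- by apply/par_piP; exact: EqRel1.
- by rewrite -[X in X * _]par_piM -[LHS]par_piM -[RHS]par_piM;
    apply/par_piP; exact: EqRel2.
- by rewrite -[X in X * _]par_piM -[LHS]par_piM -[RHS]par_piM;
    apply/par_piP; exact: EqRel3.
Qed.

Lemma par_piC c : par_pi (Cst c) = c%:A.
Proof. by rewrite [RHS]par_scaleE mulr1. Qed.

Lemma par_alg_ind (P : par_alg -> Prop) :
  (forall g, P (par_gen g)) -> (forall c, P c%:A) ->
  (forall u v, P u -> P v -> P (u + v)) ->
  (forall u v, P u -> P v -> P (u * v)) ->
  forall u, P u.
Proof.
move=> Pg Pc PD PM; elim/par_alg_quot_ind; elim=> [g|c|x Px y Py|x Px y Py].
- exact: Pg.
- by rewrite par_piC.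
- by rewrite par_piD; exact: PD.
- by rewrite par_piM; exact: PM.
Qed.

Theorem par_alg_universal (A : algType K) (f : G -> A) : partial_rep f ->
  exists2 phi : {lrmorphism par_alg -> A},
    forall g, phi (par_gen g) = f g &
    forall psi : {lrmorphism par_alg -> A},
      (forall g, psi (par_gen g) = f g) -> psi =1 phi.
Proof.
move=> rep_f; pose phi (u : par_alg) := par_eval f (par_repr u).
have phi_pi x : phi (par_pi x) = par_eval f x.
  by apply: par_evalE => //; exact: par_repr_pi.
have phiD u v : phi (u + v) = phi u + phi v.
  elim/par_alg_quot_ind: u => x; elim/par_alg_quot_ind: v => y.
  by rewrite -[_ + _]par_piD !phi_pi.
have phiZ : scalable phi.
  move=> c; elim/par_alg_quot_ind=> x.
  by rewrite -[_ *: _]par_piZ !phi_pi /= -scalerAl mul1r.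
have phiB : zmod_morphism phi.
  by move=> u v; rewrite phiD -scaleN1r phiZ scaleN1r.
have phiM : monoid_morphism phi.
  split; first by rewrite [LHS]phi_pi /= scale1r.
  elim/par_alg_quot_ind=> x; elim/par_alg_quot_ind=> y.
  by rewrite -[_ * _]par_piM !phi_pi.
pose Lphi := GRing.isZmodMorphism.Build _ _ phi phiB.
pose Mphi := GRing.isMonoidMorphism.Build _ _ phi phiM.
pose Zphi := GRing.isScalable.Build _ _ _ _ phi phiZ.
pose Phi : {lrmorphism par_alg -> A} := HB.pack phi Lphi Mphi Zphi.
have PhiE g : Phi (par_gen g) = f g by rewrite [LHS]phi_pi.
clearbody Phi; exists Phi => // psi psiE;
  elim/par_alg_ind => [g|c|u v IHu IHv|u v IHu IHv].
- by rewrite psiE PhiE.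
- by rewrite !linearZ !rmorph1.
- by rewrite !rmorphD /= IHu IHv.
- by rewrite !rmorphM /= IHu IHv.
Qed.

End PartialGroupAlgebra.

(* Main.v *)
Require Import Defs.
From HB Require Import structures.
From mathcomp Require Import all_boot all_order all_algebra all_fingroup.
From mathcomp Require Import all_solvable.

(** The partial group algebra of G is the algebra of a finite groupoid: its
    objects are the subsets B of G containing the identity, and its arrows are
    the pairs (B, g) with g in B, from B to its translate by g^-1.  Indeed the
    elements [g][g^-1] are commuting idempotents, their joint eigenprojections
    are the idempotents P_B ([cell]), and the products P_B [g] span the algebra
    and multiply like arrows ([par_alg_span], [cell_gen_mul]).  So the algebra
    is a product of rings of m x m matrices over group rings of subgroups of G,
    one for each connected component with m objects.  For abelian G these
    group rings are commutative, and the algebra then determines, for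
    every m, the number of arrows in components with m objects.

    To see this without constructing the decomposition, call an idempotent
    repeated if it has more than m orthogonal equivalent copies
    ([repeated_idem]), and consider the linear functionals vanishing on the ideal
    generated by repeated idempotents ([thin_functional]).  If the component of
    B has more than m objects then P_B is repeated, so such a functional is
    determined by its values on the arrows in components with at most m
    objects ([thin_functional_eq0]).  Conversely every such arrow has a dual
    functional, a coefficient of the representation of the algebra on a
    component by matrices over the group ring of G ([dual_thin_functional]): a
    repeated idempotent acts there by zero, since a matrix over a commutative
    ring cannot be repeated more often than its size ([repeated_idem_mx0]).
    Hence an isomorphism preserves the number of arrows in components with at
    most m objects ([leq_cell_count]).

    What remains is finite group theory.  The component of B has |B| / |S|
    objects, where S is the stabiliser of B.  If m is coprime to n = |G|, a union
    of m cosets of a subgroup H has stabiliser exactly H, and the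
    number of arrows in components with m objects is m times the sum over
    the subgroups H of |H| binom(n/|H| - 1, m - 1) ([level_count_coprime]).  An
    abelian group is determined by the numbers of its elements killed by the
    prime powers q, and these are recovered by increasing q: for
    m = n/q - 1 only G and the subgroups of order at most q contribute, the
    numbers of those of smaller order are already known, and the number of those
    of order q gives the number of elements of order q ([isog_coset_sum]). *)

Set Implicit Arguments.
Unset Strict Implicit.
Unset Printing Implicit Defensive.

(** * Abelian groups from their torsion *)

Section AbelianFromTorsion.
Local Open Scope group_scope.

(** The subgroup ['Ohm_n(G)] mixes all primes; its [p]-part is the
    [n]-th Ohm subgroup of the Sylow [p]-subgroup, and in an abelian
    [p]-group that one consists of the elements killed by [p ^ n]. *)
Lemma logn_Ohm_Ldiv (gT : finGroupType) (G : {group gT}) p n :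
    abelian G -> prime p ->
  logn p #|'Ohm_n(G)| = logn p #|'Ldiv_(p ^ n)(G)|.
Proof.
move=> cGG p_pr.
have defG := nilpotent_pcoreC p (abelian_nil cGG).
case/dprodP: (Ohm_dprod n defG) => _ <- _ /TI_cardMg->.
rewrite lognM ?cardG_gt0 // [X in (_ + X)%N](_ : _ = 0)%N; last first.
  rewrite lognE p_pr cardG_gt0 /=; case: ifP => // p_dv.
  have: p^'.-group 'Ohm_n('O_p^'(G)).
    by apply: pgroupS (Ohm_sub _ _) _; exact: pcore_pgroup.
  by move/pgroupP/(_ p p_pr p_dv); rewrite !inE eqxx.
have sylGp := nilpotent_pcore_Hall p (abelian_nil cGG).
have cGpGp : abelian 'O_p(G) by apply: abelianS cGG; exact: pcore_sub.
rewrite addn0 /=; have -> : 'Ohm_n('O_p(G)) = 'Ldiv_(p ^ n)('O_p(G)).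
  apply: OhmEabelian (pcore_pgroup p G) _.
  by apply: abelianS cGpGp; exact: Ohm_sub.
congr (logn p #|(_ : {set gT})|); apply/setP=> x.
rewrite !in_setI inE; apply: andb_id2r => /eqP xpn.
have px : p.-elt x.
  have dv: #[x] %| p ^ n by rewrite order_dvdn xpn.
  by apply: pnat_dvd dv _; rewrite pnatX pnat_id.
apply/idP/idP; first exact/subsetP/pcore_sub.
by move=> Gx; rewrite (mem_normal_Hall sylGp) ?pcore_normal.
Qed.

Lemma count_abelian_type (gT : finGroupType) (G : {group gT}) p n :
    abelian G -> prime p ->
  count [pred m | logn p m > n] (abelian_type G)
    = (logn p #|'Ldiv_(p ^ n.+1)(G)| - logn p #|'Ldiv_(p ^ n)(G)|)%N.
Proof.
move=> cGG p_pr; have [b defG <-] := abelian_structure cGG.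
rewrite count_map (count_logn_dprod_cycle p n defG) -divgS ?Ohm_leq //.
by rewrite logn_div ?cardSg ?Ohm_leq // !logn_Ohm_Ldiv.
Qed.

(** In a chain for reverse divisibility the [p]-valuations decrease, so
    the entries of valuation more than [n] are exactly the first ones: their
    number tells which they are. *)
Lemma logn_nth_dvdn_sorted p n (s : seq nat) j :
    sorted [rel a b | b %| a] s -> all [pred a | a > 1] s ->
  (n < logn p (nth 1%N s j)) = (j < count [pred a | logn p a > n] s).
Proof.
elim: s j => [|a s IHs] j; first by rewrite nth_nil logn1.
move=> /= a_s /andP[a_gt1 s_gt1].
case: (ltnP n (logn p a)) => [lt_na|le_an] /=.
  by case: j => [|j] //=; rewrite IHs // (path_sorted a_s).
have small b : b \in a :: s -> logn p b <= n.
  rewrite inE => /predU1P[-> //|s_b]; apply: leq_trans le_an.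
  apply: dvdn_leq_log; first exact: ltnW.
  have tr : transitive [rel a b | b %| a] by move=> x y z /= xy /dvdn_trans->.
  by have /allP := order_path_min tr a_s; apply.
have -> : count [pred b | n < logn p b] s = 0.
  apply/eqP; rewrite -leqn0 leqNgt -has_count; apply/hasPn=> b s_b /=.
  by rewrite -leqNgt small // inE s_b orbT.
apply/negbTE; rewrite -leqNgt.
have [lt_j|le_j] := ltnP j (size (a :: s)); last by rewrite nth_default ?logn1.
exact/small/mem_nth.
Qed.

Lemma eq_dvdn_sorted (s t : seq nat) :
    sorted [rel a b | b %| a] s -> all [pred a | a > 1] s ->
    sorted [rel a b | b %| a] t -> all [pred a | a > 1] t ->
    (forall p n, prime p ->
       count [pred a | logn p a > n] s = count [pred a | logn p a > n] t) ->
  s = t.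
Proof.
move=> s_sort s_gt1 t_sort t_gt1 eq_st.
have nth_gt0 u : all [pred a | a > 1] u -> forall j, 0 < nth 1%N u j.
  move=> u_gt1 j; have [ltj|lej] := ltnP j (size u).
    exact/ltnW/(allP u_gt1)/mem_nth.
  by rewrite nth_default.
have eq_nth j : nth 1%N s j = nth 1%N t j.
  apply: eqn_from_log; rewrite ?nth_gt0 // => p.
  have [p_pr|pr'p] := boolP (prime p); last first.
    by rewrite [LHS]lognE [RHS]lognE (negPf pr'p).
  have eq_lt n : (n < logn p (nth 1%N s j)) = (n < logn p (nth 1%N t j)).
    rewrite (logn_nth_dvdn_sorted p n j s_sort s_gt1) eq_st //.
    by rewrite (logn_nth_dvdn_sorted p n j t_sort t_gt1).
  by apply/eqP; rewrite eqn_leq leqNgt eq_lt ltnn leqNgt -eq_lt ltnn.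
have le_size u v : all [pred a | a > 1] u -> nth 1%N u =1 nth 1%N v ->
    size u <= size v.
  move=> u_gt1 eq_uv; rewrite leqNgt; apply/negP=> lt_vu.
  by have := allP u_gt1 _ (mem_nth 1%N lt_vu); rewrite /= eq_uv nth_default.
apply: (@eq_from_nth _ 1%N) => [|j _]; last exact: eq_nth.
by apply/eqP; rewrite eqn_leq !le_size // => j; rewrite eq_nth.
Qed.

(** The numbers of elements killed by each prime power give, by
    [count_abelian_type], the [p]-valuations of the invariant factors. *)
Lemma isog_abelian_Ldiv (gT rT : finGroupType) (G : {group gT})
    (H : {group rT}) :
    abelian G -> abelian H ->
    (forall p n, prime p -> #|'Ldiv_(p ^ n)(G)| = #|'Ldiv_(p ^ n)(H)|) ->
  G \isog H.
Proof.
move=> cGG cHH eqGH; rewrite eq_abelian_type_isog //; apply/eqP.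
apply: eq_dvdn_sorted; rewrite ?abelian_type_dvdn_sorted ?abelian_type_gt1 //.
by move=> p n p_pr; rewrite !count_abelian_type // !eqGH.
Qed.

End AbelianFromTorsion.

(** * Subgroups of given order in abelian groups *)

Section SubgroupCount.
Local Open Scope group_scope.

Definition subgroups_of_order (gT : finGroupType) (A : {set gT}) k :=
  [set H : {group gT} | (H \subset A) && (#|H| == k)].

Lemma leq_card_isog_subgroups (gT rT : finGroupType) (G : {group gT})
    (H : {group rT}) k :
  G \isog H -> #|subgroups_of_order G k| <= #|subgroups_of_order H k|.
Proof.
case/isogP=> f injf <-.
rewrite -(card_in_imset (f := fun L : {group gT} => (f @* L)%G)); last first.
  move=> L1 L2; rewrite !inE => /andP[sL1 _] /andP[sL2 _] /(congr1 val) /=.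
  by move=> eqL; apply/val_inj/(injm_morphim_inj injf) => //.
apply/subset_leq_card/subsetP=> _ /imsetP[L + ->]; rewrite !inE.
by case/andP=> sLG /eqP <-; rewrite morphimS //= card_injm.
Qed.

Lemma card_isog_subgroups (gT rT : finGroupType) (G : {group gT})
    (H : {group rT}) k :
  G \isog H -> #|subgroups_of_order G k| = #|subgroups_of_order H k|.
Proof.
move=> isoGH; apply/eqP; rewrite eqn_leq leq_card_isog_subgroups //=.
by rewrite leq_card_isog_subgroups // isog_sym.
Qed.

Lemma LdivI (gT : finGroupType) (A : {set gT}) a b :
  'Ldiv_a('Ldiv_b(A)) = 'Ldiv_(gcdn a b)(A).
Proof.
apply/setP=> x; rewrite !inE -!order_dvdn dvdn_gcd -andbA.
by rewrite [(#[x] %| b) && _]andbC.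
Qed.

Lemma subgroups_of_order_Ldiv (gT : finGroupType) (G : {group gT}) k :
  subgroups_of_order 'Ldiv_k(G) k = subgroups_of_order G k.
Proof.
apply/setP=> H; rewrite !inE; apply: andb_id2r => /eqP <-.
rewrite subsetI -[X in _ && X]/(H \subset 'Ldiv_#|H|()) sub_LdivT.
by rewrite exponent_dvdn andbT.
Qed.

(** A prime power dividing [k] is at most [k], so the torsion counts up
    to [k] determine the whole [k]-torsion subgroup. *)
Lemma isog_Ldiv (gT rT : finGroupType) (G : {group gT}) (H : {group rT})
    (cGG : abelian G) (cHH : abelian H) k : 0 < k ->
    (forall p i, prime p -> p ^ i <= k ->
       #|'Ldiv_(p ^ i)(G)| = #|'Ldiv_(p ^ i)(H)|) ->
  Group (group_Ldiv k cGG) \isog Group (group_Ldiv k cHH).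
Proof.
move=> k_gt0 eqGH; apply: isog_abelian_Ldiv.
- exact: abelianS (subsetIl _ _) (cGG).
- exact: abelianS (subsetIl _ _) (cHH).
move=> p n p_pr; rewrite !LdivI.
have /(dvdn_pfactor _ _ p_pr)[i _ def_d] := dvdn_gcdl (p ^ n) k.
by rewrite def_d eqGH // -def_d dvdn_leq // dvdn_gcdr.
Qed.

Lemma card_subgroups_Ldiv (gT rT : finGroupType) (G : {group gT})
    (H : {group rT}) d k : abelian G -> abelian H -> 0 < d ->
    (forall p i, prime p -> p ^ i <= d ->
       #|'Ldiv_(p ^ i)(G)| = #|'Ldiv_(p ^ i)(H)|) ->
  #|subgroups_of_order 'Ldiv_d(G) k| = #|subgroups_of_order 'Ldiv_d(H) k|.
Proof.
move=> cGG cHH d_gt0 eqGH.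
exact: (card_isog_subgroups k (isog_Ldiv cGG cHH d_gt0 eqGH)).
Qed.

Definition cyclic_subgroups (gT : finGroupType) (G : {group gT}) k :=
  [set H in subgroups_of_order G k | cyclic H].

Lemma card_elements_of_order (gT : finGroupType) (G : {group gT}) k :
  #|[set x in G | #[x] == k]| = (#|cyclic_subgroups G k| * totient k)%N.
Proof.
rewrite -sum1_card.
rewrite (partition_big (fun x => <[x]>%G) [in cyclic_subgroups G k]) /=.
  rewrite -sum_nat_const; apply: eq_bigr => H; rewrite !inE.
  case/andP=> /andP[sHG /eqP oH] /cyclicP[x defH].
  have -> : k = #[x] by rewrite -oH defH.
  rewrite totient_gen -sum1_card; apply: eq_bigl => y; rewrite !inE.
  have oH' : #[x] = k by rewrite -oH defH.
  apply/idP/idP=> [/andP[_ /eqP/(congr1 val) /= defy]|/eqP defy].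
    by rewrite /generator -defH defy.
  have defyH : <[y]> = H by rewrite defH defy.
  rewrite -cycle_subG defyH sHG orderE defyH defH eqxx /=.
  by apply/eqP/val_inj.
by move=> x; rewrite !inE => /andP[Gx /eqP ox];
  rewrite cycle_subG Gx -orderE ox eqxx cycle_cyclic.
Qed.

Lemma card_Ldiv_pfactor (gT : finGroupType) (G : {group gT}) p i : prime p ->
  #|'Ldiv_(p ^ i.+1)(G)|
    = (#|'Ldiv_(p ^ i)(G)| + #|[set x in G | #[x] == (p ^ i.+1)%N]|)%N.
Proof.
move=> p_pr; rewrite -cardsUI [X in (_ + X)%N](_ : _ = 0)%N; last first.
  apply/eqP; rewrite cards_eq0 -subset0; apply/subsetP=> x; rewrite !inE.
  rewrite -order_dvdn => /andP[/andP[_ dv] /andP[_ /eqP ox]].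
  by move: dv; rewrite ox dvdn_Pexp2l ?prime_gt1 // ltnn.
rewrite addn0; congr #|(_ : {set gT})|; apply/setP=> x; rewrite !inE.
rewrite -!order_dvdn -andb_orr; congr (_ && _).
apply/idP/orP=> [/(dvdn_pfactor _ _ p_pr)[j]|[dv|/eqP->//]].
  rewrite leq_eqVlt => /predU1P[-> ->|lt_j ->]; first by right.
  by left; rewrite dvdn_exp2l.
by apply: dvdn_trans dv _; rewrite dvdn_exp2l.
Qed.

Lemma pgroup_cyclic_exponent (gT : finGroupType) (H : {group gT}) p i :
    prime p -> abelian H -> #|H| = (p ^ i.+1)%N ->
  cyclic H = ~~ (H \subset 'Ldiv_(p ^ i)()).
Proof.
move=> p_pr cHH oH; rewrite sub_LdivT.
apply/idP/idP=> [/cyclicP[x defH]|ndv].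
  apply/negP=> dv; have /dvdn_exponent : x \in H by rewrite defH cycle_id.
  move=> /dvdn_trans/(_ dv); rewrite orderE -defH oH.
  by rewrite dvdn_Pexp2l ?prime_gt1 // ltnn.
have [x Hx expx] := exponent_witness (abelian_nil cHH).
have := exponent_dvdn H; rewrite oH => /(dvdn_pfactor _ _ p_pr)[j].
rewrite leq_eqVlt => /predU1P[->|lt_j] expH; last first.
  by case/negP: ndv; rewrite expH dvdn_exp2l.
apply/cyclicP; exists x; apply/eqP.
by rewrite eq_sym eqEcard cycle_subG Hx -orderE -expx expH oH leqnn.
Qed.

(** A subgroup of order [p ^ i.+1] is either cyclic or killed by
    [p ^ i].  This isolates the contribution of the elements of order exactly
    [p ^ i.+1] to the number of subgroups of that order. *)
Lemma card_subgroups_pfactor (gT : finGroupType) (G : {group gT}) p i :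
    prime p -> abelian G ->
  #|subgroups_of_order G (p ^ i.+1)%N|
    = (#|subgroups_of_order 'Ldiv_(p ^ i)(G) (p ^ i.+1)%N|
       + #|cyclic_subgroups G (p ^ i.+1)%N|)%N.
Proof.
move=> p_pr cGG; rewrite -(cardsID [set H : {group gT} | ~~ cyclic H]).
congr (_ + _)%N; apply: eq_card => H; rewrite !inE -!andbA.
  rewrite subsetI; case sHG: (H \subset G) => //=.
  case: eqP => [oH|]; last by rewrite andbF.
  rewrite (pgroup_cyclic_exponent p_pr _ oH) ?negbK ?andbT //.
  exact: abelianS cGG.
by rewrite negbK; do ![case: (_ \subset _) | case: (_ == _) | case: cyclic].
Qed.

End SubgroupCount.

(** * Abelian groups from sums over subgroups *)

Section CosetSums.

(** The binomial coefficient counts the unions of [m] cosets of [H] that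
    contain the identity; see [card_saturated_sets]. *)
Definition coset_sum (gT : finGroupType) (G : {group gT}) m :=
  \sum_(H : {group gT} | H \subset G)
     #|H| * 'C((#|G| %/ #|H|).-1, m.-1).

Lemma coset_sumE (gT : finGroupType) (G : {group gT}) m :
  coset_sum G m = \sum_(k < #|G|.+1)
    #|subgroups_of_order G k| * (k * 'C((#|G| %/ k).-1, m.-1)).
Proof.
pose ord_of (H : {group gT}) : 'I_#|G|.+1 := inord #|H|.
rewrite /coset_sum (partition_big ord_of xpredT) //=; apply: eq_bigr => k _.
rewrite -sum_nat_const; apply: eq_big => [H|H /andP[sHG /eqP]].
  rewrite !inE; apply: andb_id2l => sHG.
  by rewrite -(inj_eq val_inj) /= inordK // ltnS subset_leq_card.
by move/(congr1 val); rewrite /= inordK ?ltnS ?subset_leq_card // => ->.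
Qed.

Lemma subgroups_of_order_ndvd (gT : finGroupType) (G : {group gT}) k :
  ~~ (k %| #|G|) -> #|subgroups_of_order G k| = 0.
Proof.
move=> ndv; apply/eqP; rewrite cards_eq0 -subset0; apply/subsetP=> H.
by rewrite !inE => /andP[/cardSg + /eqP oH]; rewrite oH (negPf ndv).
Qed.

Lemma subgroups_of_order_full (gT : finGroupType) (G : {group gT}) :
  #|subgroups_of_order G #|G| | = 1.
Proof.
apply/eqP/cards1P; exists G; apply/setP=> H; rewrite !inE.
apply/idP/eqP=> [/andP[sHG /eqP oH]|->]; last by rewrite subxx eqxx.
by apply/val_inj/eqP; rewrite eqEcard sHG /= oH.
Qed.

(** When [p ^ i.+1] does not divide the order, [p ^ i] kills the Sylow
    [p]-subgroup, so the torsion count depends on the order only. *)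
Lemma card_Ldiv_Sylow (gT : finGroupType) (G : {group gT}) p i :
    prime p -> abelian G -> ~~ (p ^ i.+1 %| #|G|) ->
  #|('Ldiv_(p ^ i)(G))%g| = #|G|`_p.
Proof.
move=> p_pr cGG ndv; have nilG := abelian_nil cGG.
have sylGp := nilpotent_pcore_Hall p nilG.
rewrite -(card_Hall sylGp); congr #|(_ : {set gT})|; apply/setP=> x.
rewrite !inE -order_dvdn.
have le_i : logn p #|G| <= i by rewrite leqNgt -pfactor_dvdn.
apply/andP/idP=> [[Gx dv]|Gpx].
  rewrite (mem_normal_Hall sylGp) ?pcore_normal //.
  by apply: pnat_dvd dv _; rewrite pnatX pnat_id.
split; first exact: (subsetP (pcore_sub p G)).
apply: dvdn_trans (order_dvdG Gpx) _.
by rewrite (card_Hall sylGp) p_part dvdn_exp2l.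
Qed.

(** Take the least prime power [q] for which the torsion counts could
    differ.  If [q] is at least the full [p]-part of the order [n] there is
    nothing to prove.  Otherwise [m = n / q - 1] is coprime to [n], and in the
    two sums for this [m] the subgroups of order less than [q] contribute
    equally by minimality, those of order more than [q] contribute nothing
    (apart from the whole group when [m = 1]), and those of order [q] come with
    the nonzero coefficient [q * m].  Hence the numbers of subgroups of order
    [q] agree; the noncyclic ones agree by minimality, so the cyclic ones do,
    and with them the numbers of elements of order [q]. *)
Theorem isog_coset_sum (gT rT : finGroupType) (G : {group gT})
    (H : {group rT}) : abelian G -> abelian H -> #|G| = #|H| ->
    (forall m, 0 < m -> coprime m #|G| -> coset_sum G m = coset_sum H m) ->
  G \isog H.
Proof.
move=> cGG cHH eq_n eq_sum; apply: isog_abelian_Ldiv => //.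
set n := #|G| in eq_n eq_sum; have n_gt0 : 0 < n by exact: cardG_gt0.
move=> p i; have [q] := ubnP (p ^ i); elim: q p i => // q0 IH p [|i] le_q p_pr.
  have Ldiv1 (aT : finGroupType) (A : {group aT}) : 'Ldiv_1(A)%g = 1%g.
    apply/setP=> x; rewrite !inE expg1.
    by apply/andP/eqP=> [[_ /eqP]//|->]; rewrite group1 eqxx.
  by rewrite expn0 !Ldiv1 !cards1.
have {le_q IH} IH r j : prime r -> r ^ j < p ^ i.+1 ->
    #|('Ldiv_(r ^ j)(G))%g| = #|('Ldiv_(r ^ j)(H))%g|.
  by move=> r_pr lt_r; apply: IH => //; apply: leq_trans lt_r _.
have [dv|ndv] := boolP (p ^ i.+2 %| n); last first.
  by rewrite !card_Ldiv_Sylow // -?eq_n // -eq_n.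
have p_gt1 := prime_gt1 p_pr.
set q := p ^ i.+1 in IH *.
have q_gt0 : 0 < q by rewrite expn_gt0 prime_gt0.
have q_dv : q %| n by apply: dvdn_trans dv; rewrite dvdn_exp2l.
set a := n %/ q; have def_n : n = a * q by rewrite divnK.
have p_dv_a : p %| a.
  by move: dv; rewrite expnS -/q def_n dvdn_pmul2r.
have a_gt1 : 1 < a.
  apply: leq_trans p_gt1 _; apply: dvdn_leq => //.
  by move: n_gt0; rewrite def_n muln_gt0 => /andP[].
pose m := a.-1.
have m_gt0 : 0 < m by rewrite -ltnS prednK // ltnW.
have co_m_a : coprime m a by rewrite coprimePn // ltnW.
have co_m_n : coprime m n.
  by rewrite def_n coprimeMr co_m_a coprimeXr // (coprime_dvdr p_dv_a).
have le_qn : q < n.+1 by rewrite ltnS dvdn_leq.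
have eq_k k : k != q -> k * 'C((n %/ k).-1, m.-1) != 0 ->
    #|subgroups_of_order G k| = #|subgroups_of_order H k|.
  rewrite neq_ltn muln_eq0 negb_or -lt0n => /orP[lt_kq|lt_qk] /andP[k_gt0 binN0].
    rewrite -!(subgroups_of_order_Ldiv _ k).
    apply: card_subgroups_Ldiv => // r j r_pr le_rk.
    by apply: IH => //; apply: leq_ltn_trans lt_kq.
  have [k_dv|k_ndv] := boolP (k %| n); last first.
    by rewrite !subgroups_of_order_ndvd // -eq_n.
  (* Only the whole group survives here: m divides n and is coprime to n. *)
  have le_mk : m <= n %/ k.
    move: binN0; rewrite -lt0n bin_gt0 => le_m.
    have nk_gt0 : 0 < n %/ k by rewrite divn_gt0 // dvdn_leq.
    by rewrite -(prednK m_gt0) -(prednK nk_gt0) ltnS.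
  have lt_ka : n %/ k < a by rewrite ltn_divLR // {1}def_n ltn_pmul2l // ltnW.
  have def_m : n %/ k = m.
    by apply/eqP; rewrite eqn_leq le_mk andbT -ltnS prednK // ltnW.
  have m_dv : m %| n.
    by rewrite -def_m; apply/dvdnP; exists k; rewrite mulnC divnK.
  have m1 : m = 1 by apply/eqP; rewrite -(gcdn_idPl m_dv).
  have -> : k = n by rewrite -(divnK k_dv) def_m m1 mul1n.
  by rewrite {2}eq_n !subgroups_of_order_full.
have eq_q : #|subgroups_of_order G q| = #|subgroups_of_order H q|.
  have := eq_sum m m_gt0 co_m_n; rewrite !coset_sumE -eq_n -/n.
  rewrite (bigD1 (Ordinal le_qn)) //= [RHS](bigD1 (Ordinal le_qn)) //=.
  rewrite [X in (_ + X)%N = _](eq_bigr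
    (fun k : 'I_n.+1 => #|subgroups_of_order H k| * (k * 'C((n %/ k).-1, m.-1)))).
    move/addIn/eqP; rewrite eqn_pmul2r; first by move/eqP.
    by rewrite muln_gt0 q_gt0 bin_gt0 leq_pred.
  move=> k neq_kq; have [->|N0] := eqVneq (k * 'C((n %/ k).-1, m.-1)) 0.
    by rewrite !muln0.
  by congr (_ * _); apply: eq_k N0; rewrite -(inj_eq val_inj) in neq_kq.
have lt_iq : p ^ i < q by rewrite ltn_exp2l.
rewrite /q !card_Ldiv_pfactor // -/q IH //; congr (_ + _).
rewrite !card_elements_of_order; congr (_ * _).
move: eq_q; rewrite /q !card_subgroups_pfactor // -/q.
rewrite (card_subgroups_Ldiv (H := H)) // ?expn_gt0 ?prime_gt0 //.
  exact: addnI.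
by move=> r j r_pr le_r; apply: IH => //; apply: leq_ltn_trans lt_iq.
Qed.

End CosetSums.

(** * Sets containing the identity and their translates *)

Section Vertices.
Local Open Scope group_scope.
Variable gT : finGroupType.
Implicit Types (A B : {set gT}) (H : {group gT}).

(** The pairs (B, g) with [1] and [g] in [B] are the arrows of a finite
    groupoid whose objects are the sets containing [1], the arrow (B, g) joining
    [B] and [g^-1 *: B].  This is the set of objects connected to [B]. *)
Definition component B := [set x^-1 *: B | x in B].

Definition set_stab B := [set g : gT | g *: B == B].

Lemma set_stab_group_set B : group_set (set_stab B).
Proof.
apply/group_setP; split=> [|g h]; rewrite !inE; first by rewrite mul1g.
by move=> /eqP gB /eqP hB; rewrite lcosetM hB gB.
Qed.
Canonical set_stab_group B := Group (set_stab_group_set B).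

Lemma set_stabP B g : reflect (g *: B = B) (g \in set_stab B).
Proof. by rewrite inE; exact: eqP. Qed.

Lemma mem_set_stab B g x : g \in set_stab B -> (g * x \in B) = (x \in B).
Proof. by move/set_stabP=> {1}<-; rewrite mem_lcoset mulKg. Qed.

Lemma sub_set_stab H B :
  H \subset set_stab B -> forall x, x \in B -> H :* x \subset B.
Proof.
move=> sHS x Bx; apply/subsetP=> _ /rcosetP[h Hh ->].
by rewrite mem_set_stab ?(subsetP sHS).
Qed.

(** Two elements of [B] translate [B] back to the same object when they lie
    in the same right coset of the stabiliser of [B]. *)
Lemma card_component B : (#|component B| * #|set_stab B|)%N = #|B|.
Proof.
rewrite -[RHS]sum1_card (partition_big_imset (fun x => x^-1 *: B)) /=.
rewrite -sum_nat_const; apply: eq_bigr => _ /imsetP[y By ->].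
rewrite -(card_rcoset _ y) -sum1_card; apply: eq_bigl => x.
rewrite mem_rcoset.
have -> : (x^-1 *: B == y^-1 *: B) = (x * y^-1 \in set_stab B).
  rewrite inE lcosetM; apply/eqP/eqP=> [<-|eqB]; first by rewrite lcosetKV.
  by rewrite -[in LHS]eqB -!lcosetM mulgA mulVg mul1g.
symmetry; apply: andb_idl => Sxy; rewrite -(mulgKV y x) mem_set_stab //.
Qed.

Lemma card_component_gt0 B : 1 \in B -> 0 < #|component B|.
Proof.
by move=> B1; apply/card_gt0P; exists (1^-1 *: B); apply/imsetP; exists 1.
Qed.

Definition cell_count m :=
  #|[set c : {set gT} * gT |
      [&& 1 \in c.1, c.2 \in c.1 & #|component c.1| <= m]]|.

(** The number of arrows (B, g) whose component has exactly [m] objects. *)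
Definition level_count m :=
  \sum_(B : {set gT} | (1 \in B) && (#|component B| == m)) #|B|.

Lemma cell_countE m :
  cell_count m = \sum_(B : {set gT} | (1 \in B) && (#|component B| <= m)) #|B|.
Proof.
rewrite /cell_count -sum1_card.
rewrite (eq_bigl (fun c : {set gT} * gT =>
    ((1 \in c.1) && (#|component c.1| <= m)) && (c.2 \in c.1))); last first.
  by move=> c; rewrite inE -!andbA; congr (_ && _); rewrite andbC.
rewrite -(pair_big_dep (fun B => (1 \in B) && (#|component B| <= m))
   (fun B x => x \in B) (fun _ _ => 1%N)) /=.
by apply: eq_bigr => B _; rewrite sum1_card.
Qed.

Lemma cell_countS m : cell_count m.+1 = (cell_count m + level_count m.+1)%N.
Proof.
rewrite !cell_countE (bigID (fun B => #|component B| <= m)) /=.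
congr (_ + _)%N; apply: eq_bigl => B; rewrite -andbA; congr (_ && _).
  by apply/andP/idP=> [[]//|le_m]; rewrite leqW.
by rewrite -ltnNge eqn_leq.
Qed.

(** Such a set is a union of right cosets of [H], one of which is [H]
    itself, so it amounts to the choice of [m.-1] of the other cosets. *)
Lemma card_saturated_sets H m : 0 < m ->
  #|[set B : {set gT} | [&& 1 \in B, H \subset set_stab B & #|B| == (m * #|H|)%N]]|
    = 'C((#|gT| %/ #|H|).-1, m.-1).
Proof.
move=> m_gt0; pose R := rcosets H [set: gT].
have RE : #|R| = #|gT| %/ #|H|.
  by rewrite [#|R|](_ : _ = #|[set: gT] : H|) // -divgS ?subsetT ?cardsT.
have RH : gval H \in R by apply/rcosetsP; exists 1; rewrite ?rcoset1 ?inE.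
have tiR : trivIset R by case/and3P: (rcosets_partition (subsetT H)).
have cardR A : A \in R -> #|A| = #|H|.
  by case/rcosetsP=> x _ ->; rewrite card_rcoset.
have mem_cover (E : {set {set gT}}) x : E \subset R ->
    (x \in cover E) = (H :* x \in E).
  move=> sER; apply/bigcupP/idP=> [[A EA Ax]|EHx]; last first.
    by exists (H :* x); rewrite ?rcoset_refl.
  have /rcosetsP[y _ defA] := subsetP sER A EA.
  by move: Ax EA; rewrite defA => /rcoset_eqP->.
have card_cover (E : {set {set gT}}) :
    E \subset R -> #|cover E| = (#|E| * #|H|)%N.
  move=> sER; have /eqP<- := trivIsetS sER tiR.
  by rewrite -sum_nat_const; apply: eq_bigr => A /(subsetP sER)/cardR.
pose Es := [set E : {set {set gT}} | [&& E \subset R :\ gval H & #|E| == m.-1]].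
have -> : 'C((#|gT| %/ #|H|).-1, m.-1) = #|Es|.
  by rewrite -RE (cardsD1 (gval H)) RH /= -cards_draws.
have inj : {in Es &, injective (fun E => cover (gval H |: E))}.
  move=> E F; rewrite !inE => /andP[sE _] /andP[sF _] eqEF.
  have sub (D : {set {set gT}}) : D \subset R :\ gval H -> gval H |: D \subset R.
    move=> sD; rewrite subUset sub1set RH (subset_trans sD) //; exact: subD1set.
  have le (D1 D2 : {set {set gT}}) :
      D1 \subset R :\ gval H -> D2 \subset R :\ gval H ->
      cover (gval H |: D1) = cover (gval H |: D2) -> D1 \subset D2.
    move=> s1 s2 eq12; apply/subsetP=> A DA.
    have /setD1P[nA RA] := subsetP s1 A DA.
    have /rcosetsP[x _ defA] := RA.
    have := mem_cover _ x (sub _ s2); rewrite -eq12 (mem_cover _ x (sub _ s1)).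
    by rewrite -defA !inE DA orbT (negPf nA) /= => <-.
  by apply/eqP; rewrite eqEsubset; apply/andP; split; exact: le.
rewrite -(card_in_imset inj); apply: eq_card => B; rewrite inE.
apply/and3P/imsetP=> [[B1 sHB /eqP oB]|[E + ->]]; last first.
  rewrite inE => /andP[sE /eqP oE].
  have sER : gval H |: E \subset R.
    rewrite subUset sub1set RH (subset_trans sE) //; exact: subD1set.
  have nHE : gval H \notin E by apply/negP=> /(subsetP sE); rewrite !inE eqxx.
  split.
  - by rewrite mem_cover // rcoset1 setU11.
  - apply/subsetP=> h Hh; rewrite inE; apply/eqP/setP=> x.
    rewrite mem_lcoset !mem_cover // rcosetM.
    by rewrite (rcoset_id (groupVr Hh)).
  - by rewrite card_cover // cardsU1 nHE oE add1n prednK.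
pose E := rcosets H B.
have HE : gval H \in E by apply/rcosetsP; exists 1; rewrite ?rcoset1.
have sER : E \subset R by apply/imsetS/subsetT.
have defB : B = cover E.
  apply/setP=> x; rewrite mem_cover //; apply/idP/rcosetsP=> [Bx|[y By eqxy]].
    by exists x.
  by apply: (subsetP (sub_set_stab sHB By)); rewrite -eqxy rcoset_refl.
exists (E :\ gval H); last by rewrite setD1K.
rewrite inE setSD //=.
have : #|B| = (#|E| * #|H|)%N by rewrite {1}defB card_cover.
rewrite oB => /eqP; rewrite eqn_pmul2r ?cardG_gt0 // => /eqP ->.
by rewrite (cardsD1 (gval H) E) HE.
Qed.

(** A set [B] in a component of size [m] is a union of [m] cosets of its
    stabiliser.  Conversely let [B] be a union of [m] cosets of [H]: the order of
    its stabiliser over that of [H] divides both [m] and the order of the group,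
    so coprimality forces the stabiliser to be [H]. *)
Lemma level_count_coprime m : 0 < m -> coprime m #|gT| ->
  level_count m = (m * coset_sum [set: gT]%G m)%N.
Proof.
move=> m_gt0 co_m; rewrite /level_count.
rewrite (partition_big (fun B => [group of set_stab B]) xpredT) //=.
rewrite big_distrr /= [RHS](eq_bigl xpredT) => [|H]; last by rewrite subsetT.
apply: eq_bigr => H _; rewrite cardsT -card_saturated_sets //.
rewrite mulnA mulnC -sum_nat_const.
have stabE B : (m * #|H|)%N = #|B| -> H \subset set_stab B -> set_stab B = H.
  move=> oB sHS; apply/eqP; rewrite eq_sym eqEcard sHS /=.
  have dv : #|set_stab B| %| m * #|H|.
    by rewrite oB -(card_component B) dvdn_mull.
  apply: dvdn_leq; first exact: cardG_gt0.
  rewrite -(Gauss_dvdr _ (_ : coprime _ m)) // coprime_sym.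
  by apply: coprime_dvdr co_m; rewrite -cardsT cardSg ?subsetT.
apply: eq_big => [B|B /andP[/andP[B1 /eqP <-] /eqP <-]]; last first.
  by rewrite card_component.
rewrite inE -andbA; congr (_ && _).
apply/andP/andP=> [[/eqP <- /eqP <-]|[sHB /eqP oB]].
  by rewrite subxx /= card_component.
have eqS := stabE B (esym oB) sHB.
split; last by apply/eqP/val_inj.
rewrite -(eqn_pmul2r (cardG_gt0 H)) -oB -(card_component B) eqS //.
Qed.

End Vertices.

(** * Abelian groups from the sizes of components *)

Section GroupOrder.
Local Open Scope group_scope.

Lemma set_stabT (gT : finGroupType) : set_stab [set: gT] = [set: gT].
Proof.
by apply/setP=> g; rewrite !inE; apply/eqP/setP=> x; rewrite mem_lcoset !inE.
Qed.

Lemma card_componentT (gT : finGroupType) : #|component [set: gT]| = 1%N.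
Proof.
have := card_component [set: gT]; rewrite set_stabT => /eqP.
by rewrite -[X in _ == X]mul1n eqn_pmul2r ?cardG_gt0 // => /eqP.
Qed.

Lemma level_count_large (gT : finGroupType) m :
  1 < m -> #|gT| <= m -> level_count gT m = 0%N.
Proof.
move=> m_gt1 le_nm; apply: big1 => B /andP[_ /eqP oB].
have [defB|ltB] := eqVneq B [set: gT].
  by move: m_gt1; rewrite -oB defB card_componentT.
suff: m < m by rewrite ltnn.
have lt_Bn : #|B| < #|gT| by rewrite -cardsT proper_card // properT.
apply: leq_trans le_nm; rewrite -{1}oB.
by apply: leq_ltn_trans (leq_imset_card _ _) _.
Qed.

Lemma level_count_pred (gT : finGroupType) :
  1 < #|gT| -> level_count gT #|gT|.-1 != 0%N.
Proof.
move=> n_gt1; have m_gt0 : 0 < #|gT|.-1 by rewrite -ltnS prednK // ltnW.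
have co_m : coprime #|gT|.-1 #|gT| by rewrite coprimePn // ltnW.
rewrite level_count_coprime // muln_eq0 negb_or -lt0n m_gt0.
rewrite -lt0n /coset_sum (bigD1 1%G) ?sub1G //= cards1 divn1 mul1n cardsT.
by rewrite addn_gt0 bin_gt0 leq_pred.
Qed.

Lemma level_count1 (gT : finGroupType) : #|gT| <= level_count gT 1%N.
Proof.
rewrite /level_count (bigD1 [set: gT]) ?inE ?card_componentT //= cardsT.
exact: leq_addr.
Qed.

Lemma level_count_trivial (gT : finGroupType) :
  #|gT| = 1%N -> level_count gT 1%N <= 1.
Proof.
move=> n1; rewrite /level_count big_mkcond /= (bigD1 [set: gT]) //= big1 => [|B].
  by rewrite addn0; case: ifP; rewrite // cardsT n1.
rewrite -properT => /proper_card; rewrite cardsT n1 ltnS leqn0 cards_eq0.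
by move/eqP->; rewrite inE.
Qed.

(** For a group of order [n > 1] the components have at most [n - 1]
    objects, and the complement of a point other than the identity attains this
    bound.  The orders 1 and 2 are told apart by the
    components with one object. *)
Lemma leq_card_level_count (gT rT : finGroupType) :
    (forall m, 0 < m -> level_count gT m = level_count rT m) ->
  #|rT| <= #|gT|.
Proof.
move=> eq_lev; rewrite leqNgt; apply/negP=> lt_n.
have n_gt0 : 0 < #|gT| by apply/card_gt0P; exists 1.
have r_gt1 : 1 < #|rT| by apply: leq_ltn_trans lt_n.
have [r_gt2|r_le2] := ltnP 2 #|rT|.
  have m_gt1 : 1 < #|rT|.-1 by rewrite -ltnS prednK // ltnW.
  have := level_count_pred r_gt1; rewrite -eq_lev ?level_count_large ?(ltnW m_gt1) //.
  by rewrite -ltnS prednK // ltnW.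
have n1 : #|gT| = 1%N.
  by apply/eqP; rewrite eqn_leq n_gt0 andbT -ltnS (leq_trans lt_n).
have := leq_trans (level_count1 rT) _; rewrite -eq_lev //.
move=> /(_ _ (level_count_trivial n1)).
by rewrite leqNgt r_gt1.
Qed.

Theorem isog_level_count (gT rT : finGroupType) :
    abelian [set: gT] -> abelian [set: rT] ->
    (forall m, 0 < m -> level_count gT m = level_count rT m) ->
  [set: gT] \isog [set: rT].
Proof.
move=> cG cH eq_lev.
have eq_n : #|gT| = #|rT|.
  by apply/eqP; rewrite eqn_leq !leq_card_level_count // => m /eq_lev.
apply: (@isog_coset_sum _ _ [set: gT]%G [set: rT]%G) => //.
  by rewrite !cardsT.
rewrite cardsT => m m_gt0 co_m; apply/eqP; rewrite -(eqn_pmul2l m_gt0).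
by rewrite -!level_count_coprime -?eq_n // eq_lev.
Qed.

End GroupOrder.

(** * Cells of a partial representation *)

Section PartialRepresentations.
Import GRing.Theory.
Local Open Scope ring_scope.
Variables (gT : finGroupType) (R : nzRingType) (f : gT -> R).
Hypothesis rep_f : partial_rep f.
Implicit Types (g h x : gT) (B D : {set gT}).

Let f1 : f 1%g = 1. Proof. by case: rep_f. Qed.

Lemma prepV g : f g * f g^-1%g * f g = f g.
Proof.
case: rep_f => _ fl _; have := fl g^-1%g g.
by rewrite invgK mulVg f1 mulr1.
Qed.

Definition ridem g := f g * f g^-1%g.

Lemma prepMl g h : f g * f h = ridem g * f (g * h)%g.
Proof.
case: rep_f => _ fl _; rewrite -{1}[f g]prepV /ridem -!mulrA; congr (_ * _).
by have := fl g h; rewrite -mulrA.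
Qed.

Lemma ridem1 : ridem 1%g = 1.
Proof. by rewrite /ridem invg1 f1 mulr1. Qed.

Lemma ridem_f g : ridem g * f g = f g.
Proof. exact: prepV. Qed.

Lemma f_ridem g h : f g * ridem h = ridem (g * h)%g * f g.
Proof.
case: rep_f => _ _ fr; rewrite /ridem mulrA fr -/(ridem (g * h)) prepMl.
by rewrite mulgK.
Qed.

Lemma ridemC g h : ridem g * ridem h = ridem h * ridem g.
Proof.
by rewrite {1}/ridem -mulrA f_ridem mulrA f_ridem -mulrA mulKVg.
Qed.

Lemma ridem_idem g : ridem g * ridem g = ridem g.
Proof. by rewrite {2}/ridem mulrA ridem_f. Qed.

Definition cell_factor B x := if x \in B then ridem x else 1 - ridem x.

(** The joint eigenprojection of the commuting idempotents [ridem x],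
    with eigenvalue 1 for [x] in [B] and 0 elsewhere. *)
Definition cell B := \prod_(x : gT) cell_factor B x.

Lemma ridem_factor B g x : ridem g * cell_factor B x = cell_factor B x * ridem g.
Proof.
rewrite /cell_factor; case: ifP => _; first exact: ridemC.
by rewrite mulrBl mulrBr mul1r mulr1 ridemC.
Qed.

Lemma ridem_cellC B g : ridem g * cell B = cell B * ridem g.
Proof.
by apply: commr_prod => x _; exact: ridem_factor.
Qed.

Lemma ridem_cell B g : ridem g * cell B = if g \in B then cell B else 0.
Proof.
rewrite /cell; have: g \in index_enum gT by rewrite mem_index_enum.
elim: (index_enum gT) => // x s IHs; rewrite inE big_cons.
case: eqP => [<- _|_ /= /IHs {}IHs].
  rewrite mulrA /cell_factor; case: ifP => _; first by rewrite ridem_idem.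
  by rewrite mulrBr mulr1 ridem_idem subrr mul0r.
rewrite mulrA ridem_factor -mulrA IHs; case: ifP => // _; exact: mulr0.
Qed.

Lemma sum_cell : \sum_(B : {set gT}) cell B = 1.
Proof.
pose F (x : gT) (b : bool) := if b then ridem x else 1 - ridem x.
transitivity (\prod_(x : gT) \sum_(b : bool) F x b).
  rewrite bigA_distr_bigA (reindex (fun h : {ffun gT -> bool} => [set x | h x])).
    by apply: eq_bigr => h _; apply: eq_bigr => x _; rewrite /cell_factor inE.
  exists (fun B : {set gT} => [ffun x => x \in B]) => [h|B] _.
    by apply/ffunP=> x; rewrite ffunE inE.
  by apply/setP=> x; rewrite inE ffunE.
by apply: big1 => x _; rewrite big_bool /= [LHS]addrC subrK.
Qed.

(** Joint eigenvectors are separated by the cells.  Used instead of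
    permuting the factors of the products that define cells, which live in a
    noncommutative ring. *)
Lemma cell_mul_fix B D (z : R) :
    (forall x, ridem x * z = if x \in D then z else 0) ->
  cell B * z = if B == D then z else 0.
Proof.
move=> zD.
have cell0 C : C != D -> cell C * z = 0.
  move=> neq; case: (set_0Vmem (C :\: D)) => [CD0|[x]].
    have /subsetPn[x Dx C'x] : ~~ (D \subset C).
      by apply: contra neq => sDC; rewrite eqEsubset sDC andbT -setD_eq0 CD0.
    have := zD x; rewrite Dx => {1}<-.
    by rewrite mulrA -ridem_cellC ridem_cell (negPf C'x) mul0r.
  rewrite !inE => /andP[D'x Cx].
  have := ridem_cell C x; rewrite Cx => {1}<-.
  by rewrite ridem_cellC -mulrA zD (negPf D'x) mulr0.
case: eqP => [->|/eqP]; last exact: cell0.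
rewrite -[RHS]mul1r -sum_cell mulr_suml (bigD1 D) //= [X in _ + X]big1 ?addr0 //.
Qed.

Lemma cellM B D : cell B * cell D = if B == D then cell B else 0.
Proof.
by rewrite (cell_mul_fix B (ridem_cell D)); case: eqP => // ->.
Qed.

Lemma f_cell g D : f g * cell D = cell (g *: D)%g * f g.
Proof.
have fgD C : f g * cell C = cell (g *: C)%g * (f g * cell C).
  rewrite (@cell_mul_fix _ (g *: C)%g) ?eqxx // => x.
  have fx : f g * ridem (g^-1 * x)%g = ridem x * f g by rewrite f_ridem mulKVg.
  rewrite mulrA -fx -mulrA ridem_cell mem_lcoset.
  by case: ifP => // _; exact: mulr0.
(* Cut the right side by all cells: only the one of D survives. *)
rewrite fgD -[in RHS](mulr1 (f g)) -sum_cell !mulr_sumr [RHS](bigD1 D) //=.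
rewrite [X in _ + X]big1 ?addr0 // => C neqCD.
by rewrite fgD mulrA cellM (inj_eq (@lcoset_inj _ g)) eq_sym (negPf neqCD) mul0r.
Qed.

Lemma cell_notin1 B : 1%g \notin B -> cell B = 0.
Proof.
by move=> B'1; have := ridem_cell B 1%g; rewrite ridem1 mul1r (negPf B'1).
Qed.

Lemma cell_f B g : g \notin B -> cell B * f g = 0.
Proof.
move=> B'g; rewrite -(ridem_f g) mulrA -ridem_cellC ridem_cell.
by rewrite (negPf B'g) mul0r.
Qed.

Lemma cell_fM B g h : g \in B -> cell B * f g * f h = cell B * f (g * h)%g.
Proof. by move=> Bg; rewrite -mulrA prepMl mulrA -ridem_cellC ridem_cell Bg. Qed.

(** The products [cell B * f g] multiply like the arrows of the groupoid
    of translates. *)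
Lemma cell_gen_mul B g D h :
  (cell B * f g) * (cell D * f h)
    = if (B == g *: D)%g && (g \in B) then cell B * f (g * h)%g else 0.
Proof.
rewrite -!mulrA [f g * _]mulrA f_cell !mulrA cellM.
case: eqP => [_|_] /=; last by rewrite !mul0r.
by case: ifPn => [Bg|/cell_f->]; [rewrite cell_fM | rewrite mul0r].
Qed.

End PartialRepresentations.

(** * Matrices that factor through a smaller size *)

Section NarrowMatrices.
Import GRing.Theory.
Local Open Scope ring_scope.

Lemma det_col0 (R : comNzRingType) n (A : 'M[R]_n) j :
  (forall i, A i j = 0) -> \det A = 0.
Proof.
by move=> A0; rewrite (expand_det_col _ j) big1 // => i _; rewrite A0 mul0r.
Qed.

Lemma det_mul_narrow (R : comNzRingType) r n (W : 'M[R]_(r, n))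
    (Z : 'M[R]_(n, r)) : (n < r)%N -> \det (W *m Z) = 0.
Proof.
move=> lt_nr; have [d def_r] : exists d, r = (n + d.+1)%N.
  by exists (r - n).-1; rewrite prednK ?subn_gt0 // subnKC // ltnW.
(* Padding with zeros makes both factors square. *)
subst r; rewrite -[W *m Z]addr0 -(mul0mx _ (0 : 'M_(d.+1, _))) -mul_row_col.
rewrite det_mulmx (@det_col0 _ _ (row_mx W 0) (rshift n ord0)) ?mul0r // => i.
by rewrite row_mxEr mxE.
Qed.

Lemma narrow_kernel (R : idomainType) p q (M : 'M[R]_(p, q)) : (q < p)%N ->
  exists2 v : 'rV[R]_p, v != 0 & v *m M = 0.
Proof.
move=> lt_qp; have [d def_p] : exists d, p = (q + d.+1)%N.
  by exists (p - q).-1; rewrite prednK ?subn_gt0 // subnKC // ltnW.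
subst p; have /eqP/det0P[v v_neq0] : \det (row_mx M 0 : 'M_(q + d.+1)) = 0.
  by apply: (@det_col0 _ _ _ (rshift q ord0)) => i; rewrite row_mxEr mxE.
rewrite mul_mx_row => /eqP; rewrite row_mx_eq0 => /andP[/eqP vM0 _].
by exists v.
Qed.

(** For one nilpotent [a], multiply [z] by the largest power of [a] that
    does not kill [P]; treat the elements of [s] in turn. *)
Lemma nilpotent_common_kill (R : comNzRingType) n (P : 'M[R]_n) (s : seq R) :
    P != 0 -> (forall a, a \in s -> exists k, a ^+ k = 0) ->
  exists2 z, z *: P != 0 & forall a, a \in s -> (z * a) *: P = 0.
Proof.
move=> P_neq0; elim: s => [|a s IHs] nil_s; first by exists 1; rewrite ?scale1r.
have [b s_b|z zP zs] := IHs; first by apply: nil_s; rewrite inE s_b orbT.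
have [k ak0] := nil_s a (mem_head a s).
have ex : exists k, (z * a ^+ k) *: P == 0.
  by exists k; rewrite ak0 mulr0 scale0r.
(* The least exponent e.+1 that kills P; the power e does not. *)
case: (ex_minnP ex) => -[|e] /eqP ze0 min_e.
  by case/eqP: zP; rewrite -ze0 expr0 mulr1.
exists (z * a ^+ e); first by apply/negP=> /min_e; rewrite ltnn.
move=> b; rewrite inE => /predU1P[->|s_b]; first by rewrite -mulrA -exprSr.
by rewrite mulrAC mulrC -scalerA zs // scaler0.
Qed.

(** A scalar [z] that kills the products of [P] with its own entries
    kills [P = P *m P]. *)
Lemma idem_nilpotent_mx0 (R : comNzRingType) n (P : 'M[R]_n) :
    P *m P = P -> (forall i j, exists k, P i j ^+ k = 0) -> P = 0.
Proof.
move=> idemP nilP; apply/eqP; apply: contraT => P_neq0.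
have [z zP zs] : exists2 z, z *: P != 0 & forall i j, (z * P i j) *: P = 0.
  pose s := [seq P c.1 c.2 | c : 'I_n * 'I_n].
  have [a /mapP[c _ ->]|z zP zs] := nilpotent_common_kill (s := s) P_neq0.
    exact: nilP.
  by exists z => // i j; apply: zs; apply/mapP; exists (i, j); rewrite ?mem_enum.
case/eqP: zP; rewrite -idemP; apply/matrixP=> i j; rewrite !mxE mulr_sumr.
apply: big1 => l _; have /matrixP/(_ l j) := zs i l.
by rewrite !mxE mulrA.
Qed.

(** Over a field [P] would have [r] independent copies of its image inside
    an [n]-dimensional space.  Over a commutative ring, the entry (a, b) of [P]
    times the identity of size [r] is a product of matrices through size [n < r],
    by row [a] of the [X i] and column [b] of the [Y l]; so its determinant, a
    power of this entry, vanishes. *)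
Lemma repeated_idem_mx0 (R : comNzRingType) n r (P : 'M[R]_n)
    (X Y : 'I_r -> 'M[R]_n) : (n < r)%N -> P *m P = P ->
    (forall i l, X i *m Y l = if i == l then P else 0) -> P = 0.
Proof.
move=> lt_nr idemP XY; apply: idem_nilpotent_mx0 => // a b; exists r.
pose W : 'M_(r, n) := \matrix_(i, k) X i a k.
pose Z : 'M_(n, r) := \matrix_(k, l) Y l k b.
rewrite -det_scalar -(det_mul_narrow W Z lt_nr); congr (\det _).
apply/matrixP=> i l; rewrite !mxE.
transitivity ((X i *m Y l) a b); first by rewrite XY; case: eqP; rewrite ?mxE.
by rewrite mxE; apply: eq_bigr => k _; rewrite !mxE.
Qed.

End NarrowMatrices.

(** * Functionals that vanish on repeated idempotents *)

Section ThinFunctionals.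
Import GRing.Theory.
Local Open Scope ring_scope.
Variable K : idomainType.

(** The image of [p] is repeated [m.+1] times as a direct summand: the
    [y i * p * x i] are orthogonal idempotents, all equivalent to [p]. *)
Definition repeated_idem (A : nzRingType) m (p : A) :=
  p * p = p /\ exists x y : 'I_m.+1 -> A,
    forall i l, x i * y l = if i == l then p else 0.

(** A linear functional on the quotient of [A] by the ideal generated by
    the idempotents repeated more than [m] times.  When [A] is a product of
    matrix rings over commutative rings this quotient keeps the factors of size
    at most [m]. *)
Definition thin_functional (A : algType K) m (l : A -> K) :=
  (forall c u v, l (c *: u + v) = c * l u + l v) /\
  (forall a p b, repeated_idem m p -> l (a * p * b) = 0).

Lemma repeated_idem_morph (A B : nzRingType) (g : {rmorphism A -> B}) m p :
  repeated_idem m p -> repeated_idem m (g p).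
Proof.
case=> pp [x [y xy]]; split; first by rewrite -rmorphM pp.
exists (g \o x), (g \o y) => i l; rewrite /= -rmorphM xy.
by case: ifP => // _; rewrite rmorph0.
Qed.

Lemma thin_functional_comp (A B : algType K) (g : {lrmorphism A -> B}) m l :
  thin_functional m l -> thin_functional m (l \o g).
Proof.
case=> lin_l l0; split=> [c u v|a p b rep_p] /=; first by rewrite linearP lin_l.
by rewrite !rmorphM; apply/l0/repeated_idem_morph.
Qed.

Lemma thin_functional_sum (A : algType K) m (I : finType) (c : I -> K)
    (l : I -> A -> K) :
    (forall i, thin_functional m (l i)) ->
  thin_functional m (fun u => \sum_i c i * l i u).
Proof.
move=> thin_l; split=> [d u v|a p b rep_p].
  rewrite mulr_sumr -big_split; apply: eq_bigr => i _ /=.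
  by have [-> _] := thin_l i; rewrite mulrDr mulrCA.
by rewrite big1 // => i _; have [_ ->] := thin_l i; rewrite ?mulr0.
Qed.

Lemma inverse_lrmorphism (A B : algType K) (f : {lrmorphism A -> B}) :
  bijective f -> exists2 g : {lrmorphism B -> A}, cancel f g & cancel g f.
Proof.
case=> g fK gK; have f_inj := can_inj fK.
have gB : zmod_morphism g.
  move=> u v; apply: f_inj; rewrite gK rmorphB.
  by congr (_ - _); exact: esym (gK _).
have gM : monoid_morphism g.
  split=> [|u v]; apply: f_inj; rewrite gK ?rmorph1 ?rmorphM //.
  by congr (_ * _); exact: esym (gK _).
have gZ : scalable g.
  move=> c u; apply: f_inj; rewrite gK linearZ.
  by congr (_ *: _); exact: esym (gK _).
pose Lg := GRing.isZmodMorphism.Build _ _ g gB.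
pose Mg := GRing.isMonoidMorphism.Build _ _ g gM.
pose Zg := GRing.isScalable.Build _ _ _ _ g gZ.
pose h : {lrmorphism B -> A} := HB.pack g Lg Mg Zg.
by exists h.
Qed.

(** Comparing dimensions without bases or fields: the [d x] are independent
    thin functionals on [A], and the points [b y] separate those on [B]. *)
Lemma leq_card_thin (A B : algType K) (f : {lrmorphism A -> B}) m
    (X Y : finType) (a : X -> A) (d : X -> A -> K) (b : Y -> B) :
    bijective f ->
    (forall x, thin_functional m (d x)) ->
    (forall x x', d x (a x') = (x == x')%:R) ->
    (forall l : B -> K, thin_functional m l -> (forall y, l (b y) = 0) ->
       forall u, l u = 0) ->
  (#|X| <= #|Y|)%N.
Proof.
move=> /inverse_lrmorphism[g fK gK] thin_d da sep.
rewrite leqNgt; apply/negP=> lt_YX.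
pose M := \matrix_(i < #|X|, j < #|Y|) d (enum_val i) (g (b (enum_val j))).
have [v v_neq0 vM0] := narrow_kernel M lt_YX.
pose l u := \sum_i v 0 i * d (enum_val i) u.
have thin_l : thin_functional m (l \o g).
  by apply: thin_functional_comp; apply: thin_functional_sum => i.
have l0 : forall u, (l \o g) u = 0.
  apply: sep thin_l _ => y; have /matrixP/(_ 0 (enum_rank y)) := vM0.
  rewrite !mxE => <-; apply: eq_bigr => i _; by rewrite mxE enum_rankK.
case/eqP: v_neq0; apply/rowP=> i; rewrite mxE.
have := l0 (f (a (enum_val i))); rewrite /= fK /l (bigD1 i) //= da eqxx mulr1.
rewrite big1 ?addr0 // => j neq_ji.
by rewrite da (inj_eq enum_val_inj) (negPf neq_ji) mulr0.
Qed.

End ThinFunctionals.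

(** * Commutative group algebras and restriction of scalars *)

Section GroupAlgebra.
Import GRing.Theory.
Local Open Scope ring_scope.
Variables (K : idomainType) (gT : finGroupType).

(** The convolution product is commutative because the group is, whence the
    proof argument. *)
Definition group_alg of abelian [set: gT] : Type := {ffun gT -> K}.

Variable cGG : abelian [set: gT].
Local Notation KG := (group_alg cGG).
HB.instance Definition _ := GRing.Zmodule.copy KG {ffun gT -> K}.

Let mulgC (x y : gT) : (x * y = y * x)%g.
Proof. by apply: (centsP cGG); rewrite inE. Qed.

Definition ga_mul (a b : KG) : KG := [ffun g => \sum_h a h * b (h^-1 * g)%g].
Definition ga_gen (g : gT) : KG := [ffun h => (h == g)%:R].

Lemma ga_mulA : associative ga_mul.
Proof.
move=> a b c; apply/ffunP=> g; rewrite !ffunE.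
under eq_bigr => k _ do rewrite ffunE mulr_sumr.
under [RHS]eq_bigr => h _ do rewrite ffunE mulr_suml.
rewrite [RHS]exchange_big; apply: eq_bigr => k _ /=.
rewrite [RHS](reindex_inj (mulgI k)); apply: eq_bigr => l _ /=.
by rewrite mulKg invMg mulgA mulrA.
Qed.

Lemma ga_mulC : commutative ga_mul.
Proof.
move=> a b; apply/ffunP=> g; rewrite !ffunE.
rewrite (reindex_inj invg_inj) (reindex_inj (mulIg g^-1%g)).
apply: eq_bigr => k _ /=.
by rewrite invgK mulgKV mulrC invMg invgK mulgC.
Qed.

Lemma ga_mul_gen g (b : KG) : ga_mul (ga_gen g) b = [ffun x => b (g^-1 * x)%g].
Proof.
apply/ffunP=> x; rewrite !ffunE (bigD1 g) //= ffunE eqxx mul1r.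
by rewrite big1 ?addr0 // => h /negPf neq_hg; rewrite ffunE neq_hg mul0r.
Qed.

Lemma ga_mul1 : left_id (ga_gen 1%g) ga_mul.
Proof.
by move=> b; rewrite ga_mul_gen; apply/ffunP=> x; rewrite ffunE invg1 mul1g.
Qed.

Lemma ga_mulDl : left_distributive ga_mul +%R.
Proof.
move=> a b c; apply/ffunP=> g; rewrite !ffunE -big_split /=.
by apply: eq_bigr => h _; rewrite ffunE mulrDl.
Qed.

Lemma ga_gen1_neq0 : ga_gen 1%g != 0.
Proof.
by apply/eqP=> /ffunP/(_ 1%g)/eqP; rewrite !ffunE eqxx oner_eq0.
Qed.

HB.instance Definition _ := GRing.Zmodule_isComNzRing.Build KG
  ga_mulA ga_mulC ga_mul1 ga_mulDl ga_gen1_neq0.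

Lemma ga_genM g h : ga_gen (g * h)%g = ga_gen g * ga_gen h.
Proof.
rewrite [RHS]ga_mul_gen; apply/ffunP=> x; rewrite !ffunE; congr (_%:R).
by rewrite -(inj_eq (mulgI g^-1%g)) mulKg.
Qed.

Definition ga_cst (c : K) : KG := [ffun h => c *+ (h == 1%g)].

Lemma ga_cstM c (a : KG) g : (ga_cst c * a) g = c * a g.
Proof.
rewrite ffunE (bigD1 1%g) //= ffunE eqxx invg1 mul1g.
by rewrite big1 ?addr0 // => h /negPf neq_h1; rewrite ffunE neq_h1 mul0r.
Qed.

Lemma ga_cst_zmod : zmod_morphism ga_cst.
Proof. by move=> c d; apply/ffunP=> g; rewrite !ffunE mulrnBl. Qed.

Lemma ga_cst_monoid : monoid_morphism ga_cst.
Proof.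
split=> [|c d]; first by apply/ffunP=> g; rewrite !ffunE.
by apply/ffunP=> g; rewrite ga_cstM !ffunE mulrnAr.
Qed.

HB.instance Definition _ := GRing.isZmodMorphism.Build K KG ga_cst ga_cst_zmod.
HB.instance Definition _ := GRing.isMonoidMorphism.Build K KG ga_cst ga_cst_monoid.

End GroupAlgebra.

Section ScalarRestriction.
Import GRing.Theory.
Local Open Scope ring_scope.
Variables (K C : comNzRingType).

(** [A] as an algebra over [K] along [iota], so that the universal property
    over [K] applies to matrices with entries in a larger ring. *)
Definition scalar_restriction of {rmorphism K -> C} := fun A : algType C => A : Type.

Variables (iota : {rmorphism K -> C}) (A : algType C).
Local Notation rA := (scalar_restriction iota A).
HB.instance Definition _ := GRing.NzRing.copy rA A.

Definition sr_scale (c : K) (u : rA) : rA := iota c *: (u : A).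

Lemma sr_scaleA a b (u : rA) : sr_scale a (sr_scale b u) = sr_scale (a * b) u.
Proof. by rewrite /sr_scale rmorphM scalerA. Qed.

Lemma sr_scale1 : left_id 1 sr_scale.
Proof. by move=> u; rewrite /sr_scale rmorph1 scale1r. Qed.

Lemma sr_scaleDr : right_distributive sr_scale +%R.
Proof. by move=> a u v; rewrite /sr_scale scalerDr. Qed.

Lemma sr_scaleDl (u : rA) : {morph sr_scale^~ u : a b / a + b}.
Proof. by move=> a b; rewrite /sr_scale rmorphD scalerDl. Qed.

HB.instance Definition _ := GRing.Zmodule_isLmodule.Build K rA
  sr_scaleA sr_scale1 sr_scaleDr sr_scaleDl.

Lemma sr_scaleAl (a : K) (u v : rA) : a *: (u * v) = (a *: u) * v.
Proof. exact: scalerAl. Qed.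

HB.instance Definition _ := GRing.Lmodule_isLalgebra.Build K rA sr_scaleAl.

Lemma sr_scaleAr (a : K) (u v : rA) : a *: (u * v) = u * (a *: v).
Proof. exact: scalerAr. Qed.

HB.instance Definition _ := GRing.Lalgebra_isAlgebra.Build K rA sr_scaleAr.

End ScalarRestriction.

(** * The representation on a component *)

Section VertexRepresentation.
Import GRing.Theory.
Local Open Scope ring_scope.
Variables (gT : finGroupType) (C : comNzRingType) (z : gT -> C).
Hypotheses (z1 : z 1%g = 1) (zM : forall g h, z (g * h)%g = z g * z h).
Variables (n : nat) (D : 'I_n.+1 -> {set gT}) (next : gT -> 'I_n.+1 -> 'I_n.+1).
Hypotheses (D_inj : injective D) (D1 : forall i, 1%g \in D i).
Hypothesis nextE : forall g i, g \in D i -> D (next g i) = (g^-1 *: D i)%g.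

(** The rows are indexed by the objects [D i] of a component; [g] moves
    [D i] to [g^-1 *: D i] when the latter contains [1], with weight [z g].
    The weights make it possible to read [g] off the matrix. *)
Definition vertex_mx g : 'M[C]_n.+1 :=
  \matrix_(i, k) if (g \in D i) && (k == next g i) then z g else 0.

Lemma vertex_mxM g (M : 'M[C]_n.+1) i k :
  (vertex_mx g * M) i k = if g \in D i then z g * M (next g i) k else 0.
Proof.
rewrite mxE (bigD1 (next g i)) //= mxE eqxx andbT big1 ?addr0 => [|l /negPf neq].
  by case: ifP => // _; rewrite mul0r.
by rewrite mxE neq andbF mul0r.
Qed.

Lemma next_mem g h i : g \in D i -> (h \in D (next g i)) = (g * h \in D i)%g.
Proof. by move=> Dg; rewrite nextE // mem_lcoset invgK. Qed.

Lemma nextM g h i : g \in D i -> (g * h \in D i)%g ->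
  next h (next g i) = next (g * h)%g i.
Proof.
move=> Dg Dgh; apply: D_inj; rewrite nextE ?next_mem // !nextE //.
by rewrite -lcosetM invMg.
Qed.

Lemma next1 i : next 1%g i = i.
Proof. by apply: D_inj; rewrite nextE // invg1 mul1g. Qed.

Lemma vertex_mx_rep : partial_rep vertex_mx.
Proof.
have VE s t i k : (vertex_mx s * vertex_mx t) i k =
    if (s \in D i) && ((s * t)%g \in D i) && (k == next (s * t)%g i)
    then z (s * t)%g else 0.
  rewrite vertex_mxM mxE; case Ds: (s \in D i) => //=; rewrite next_mem //.
  by case Dst: (s * t \in D i)%g => //=; rewrite ?nextM //= ?mulr0 //;
    case: eqP => _; rewrite ?zM ?mulr0.
split=> [|s t|s t].
- apply/matrixP=> i k; rewrite !mxE D1 next1 z1 /= eq_sym.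
  by case: eqP.
- rewrite -mulrA; apply/matrixP=> i k; rewrite vertex_mxM !VE mulKg.
  case Ds: (s^-1 \in D i)%g => //=.
  rewrite !next_mem // mulVg D1 mulKg /=; case Dt: (t \in D i) => /=.
    rewrite nextM ?mulKg //; case: eqP => _; last exact: mulr0.
    by rewrite -zM mulKg.
  exact: mulr0.
- rewrite -mulrA; apply/matrixP=> i k; rewrite vertex_mxM !VE mulgK mulgV.
  case Ds: (s \in D i) => /=; last by rewrite andbF.
  rewrite !next_mem // mulg1 Ds !andbT next1.
  case Dst: (s * t \in D i)%g => /=; last exact: mulr0.
  by case: eqP => _; rewrite ?mulr0 // z1 mulr1.
Qed.

End VertexRepresentation.

(** * Thin functionals on the partial group algebra *)

Section ComponentFunctionals.
Import GRing.Theory.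
Local Open Scope ring_scope.
Variables (K : idomainType) (gT : finGroupType).
Implicit Types (B : {set gT}) (c : {set gT} * gT).
Local Notation KP := (par_alg K gT).
Local Notation gen := (@par_gen K gT).
Local Notation rep_gen := (@par_gen_rep K gT).

(** The arrow of the groupoid given by a set and a group element, as an
    element of the algebra. *)
Definition matrix_cell c : KP := cell gen c.1 * gen c.2.

Lemma par_alg_span (u : KP) :
  exists k : {set gT} * gT -> K, u = \sum_c k c *: matrix_cell c.
Proof.
pose spanned v := exists k : {set gT} * gT -> K, v = \sum_c k c *: matrix_cell c.
have span0 : spanned 0.
  by exists (fun=> 0); rewrite big1 // => c _; rewrite scale0r.
have spanD v w : spanned v -> spanned w -> spanned (v + w).
  case=> k -> [k' ->]; exists (fun c => k c + k' c).
  by rewrite -big_split; apply: eq_bigr => c _; rewrite /= scalerDl.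
have spanZ a v : spanned v -> spanned (a *: v).
  case=> k ->; exists (fun c => a * k c).
  by rewrite scaler_sumr; apply: eq_bigr => c _; rewrite scalerA.
have span_sum (I : finType) (F : I -> KP) :
    (forall i, spanned (F i)) -> spanned (\sum_i F i).
  by move=> sF; elim/big_ind: _ => // i _.
have span_cell c : spanned (matrix_cell c).
  exists (fun c' => (c' == c)%:R); rewrite (bigD1 c) //= eqxx scale1r.
  by rewrite big1 ?addr0 // => c' /negPf->; rewrite scale0r.
have span_gen g : spanned (gen g).
  rewrite -[gen g]mul1r -(sum_cell gen) mulr_suml; apply: span_sum => B.
  exact: (span_cell (B, g)).
elim/par_alg_ind: u => [g|a|v w|v w [k ->] [k' ->]]; first exact: span_gen.
- by apply: spanZ; have [<- _ _] := rep_gen; exact: span_gen.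
- exact: spanD.
rewrite mulr_suml; apply: (span_sum) => c; rewrite -scalerAl; apply: (spanZ).
rewrite mulr_sumr; apply: span_sum => c'; rewrite -scalerAr; apply: spanZ.
rewrite /matrix_cell (cell_gen_mul rep_gen); case: ifP => // _.
exact: (span_cell (c.1, (c.2 * c'.2)%g)).
Qed.

(** The cells of the objects in one component are equivalent orthogonal
    idempotents, through the arrows between them. *)
Lemma repeated_idem_cell (R : nzRingType) (f : gT -> R) B m :
  partial_rep f -> (m < #|component B|)%N -> repeated_idem m (cell f B).
Proof.
move=> rep_f lt_m; split; first by rewrite cellM // eqxx.
pose A (i : 'I_m.+1) := nth set0 (enum (component B)) i.
have lt_i (i : 'I_m.+1) : (i < size (enum (component B)))%N.
  by rewrite -cardE (leq_trans (ltn_ord i)).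
have A_inj : injective A.
  by move=> i l /eqP; rewrite nth_uniq ?enum_uniq // => /eqP/val_inj.
have /fin_all_exists2[x Bx defA] (i : 'I_m.+1) :
    exists2 y, y \in B & A i = (y^-1 *: B)%g.
  have: A i \in component B by rewrite -mem_enum mem_nth.
  by case/imsetP=> y By ->; exists y.
exists (fun i => cell f B * f (x i)), (fun i => f (x i)^-1%g * cell f B) => i l.
rewrite f_cell // mulrA -[cell f _ * f _ * _]mulrA f_cell // !mulrA cellM //.
rewrite -lcosetM.
have -> : (B == (x i * (x l)^-1) *: B)%g = (i == l).
  rewrite -(inj_eq A_inj) !defA -[RHS](inj_eq (@lcoset_inj _ (x i))).
  by rewrite -!lcosetM mulgV mul1g.
case: eqP => [->|_]; last by rewrite !mul0r.
by rewrite -mulrA -/(ridem f _) -ridem_cellC // ridem_cell // Bx.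
Qed.

Lemma thin_functional_eq0 m (l : KP -> K) : thin_functional m l ->
    (forall c, [&& 1%g \in c.1, c.2 \in c.1 & (#|component c.1| <= m)%N] ->
       l (matrix_cell c) = 0) ->
  forall u, l u = 0.
Proof.
move=> [lin_l l_idem] l_cell u.
have l0 : l 0 = 0.
  by have := lin_l (-1) 0 0; rewrite scaler0 addr0 mulN1r addNr.
have lD v w : l (v + w) = l v + l w.
  by have := lin_l 1 v w; rewrite scale1r mul1r.
have lZ a v : l (a *: v) = a * l v.
  by have := lin_l a v 0; rewrite l0 !addr0.
have [k ->] := par_alg_span u.
rewrite (big_morph l lD l0); apply: big1 => c _.
rewrite lZ; suff -> : l (matrix_cell c) = 0 by rewrite mulr0.
have [c1|c'1] := boolP (1%g \in c.1); last first.
  by rewrite /matrix_cell (cell_notin1 rep_gen) ?mul0r.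
have [c2|c'2] := boolP (c.2 \in c.1); last by rewrite /matrix_cell (cell_f rep_gen).
have [le_m|lt_m] := leqP #|component c.1| m; first by rewrite l_cell // c1 c2.
rewrite /matrix_cell -[cell _ _]mul1r; apply: l_idem.
exact: (repeated_idem_cell rep_gen).
Qed.

Lemma component_enum B : 1%g \in B ->
  exists n (D : 'I_n.+1 -> {set gT}) (next : gT -> 'I_n.+1 -> 'I_n.+1),
  [/\ n.+1 = #|component B|, injective D, forall i, 1%g \in D i,
      forall g i, g \in D i -> D (next g i) = (g^-1 *: D i)%g
    & forall A, A \in component B -> exists i, D i = A].
Proof.
move=> B1; set C := component B.
have C_gt0 : (0 < #|C|)%N by exact: card_component_gt0.
exists #|C|.-1; pose D (i : 'I_#|C|.-1.+1) := nth set0 (enum C) i.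
have lt_i (i : 'I_#|C|.-1.+1) : (i < size (enum C))%N.
  by rewrite -cardE -[X in (_ < X)%N](prednK C_gt0).
have CD i : D i \in C by rewrite -mem_enum mem_nth.
have D_surj A : A \in C -> exists i, D i = A.
  move=> CA; have lt_A : (index A (enum C) < #|C|.-1.+1)%N.
    by rewrite prednK // cardE index_mem mem_enum.
  by exists (Ordinal lt_A); rewrite /D /= nth_index ?mem_enum.
pose next g i := odflt i [pick k | D k == (g^-1 *: D i)%g].
exists D, next; split=> //; first by rewrite prednK.
- by move=> i l /eqP; rewrite nth_uniq ?enum_uniq // => /eqP/val_inj.
- move=> i; have /imsetP[x Bx ->] := CD i.
  by rewrite mem_lcoset invgK mulg1.
move=> g i Dg; rewrite /next; case: pickP => [k /eqP //|no_k] /=.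
have /imsetP[x Bx defD] := CD i.
have [k /eqP] : exists k, D k = (g^-1 *: D i)%g.
  apply: D_surj; apply/imsetP; exists (x * g)%g.
    by move: Dg; rewrite defD mem_lcoset invgK.
  by rewrite defD -lcosetM invMg.
by rewrite no_k.
Qed.

Lemma cell_vertex_mx (C : comNzRingType) (z : gT -> C) n
    (D : 'I_n.+1 -> {set gT}) next :
    z 1%g = 1 -> (forall g h, z (g * h)%g = z g * z h) -> injective D ->
    (forall i, 1%g \in D i) ->
    (forall g i, g \in D i -> D (next g i) = (g^-1 *: D i)%g) ->
  forall B M i k,
    (cell (vertex_mx z D next) B * M) i k = if D i == B then M i k else 0.
Proof.
move=> z1 zM D_inj D1 nextE B M i k.
have rep := vertex_mx_rep z1 zM D_inj D1 nextE.
have ridemE g l k' : ridem (vertex_mx z D next) g l k'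
    = ((g \in D l) && (l == k'))%:R.
  rewrite /ridem vertex_mxM mxE; case Dg: (g \in D l) => //=.
  rewrite (next_mem nextE) // mulgV D1 (nextM D_inj nextE) ?mulgV //=.
  rewrite (next1 D_inj D1 nextE) eq_sym; case: eqP => _; last exact: mulr0.
  by rewrite -zM mulgV z1.
have cellE l l' : cell (vertex_mx z D next) B l l' = ((D l == B) && (l == l'))%:R.
  have fixD x : ridem (vertex_mx z D next) x * delta_mx l' l'
      = if x \in D l' then delta_mx l' l' else 0.
    apply/matrixP=> a b; rewrite mxE (bigD1 a) //= big1 ?addr0; last first.
      by move=> j neq; rewrite ridemE eq_sym (negPf neq) andbF mul0r.
    rewrite ridemE eqxx andbT; have [->|neq] := eqVneq a l'.
      by case: (x \in D l'); rewrite ?mul1r ?mul0r ?mxE.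
    by rewrite mxE (negPf neq) mulr0; case: ifP; rewrite mxE ?(negPf neq).
  have := cell_mul_fix rep B fixD => /matrixP/(_ l l').
  rewrite mxE (bigD1 l') //= big1 ?addr0 => [|j neq]; last first.
    by rewrite mxE (negPf neq) mulr0.
  rewrite mxE !eqxx mulr1 => ->; rewrite eq_sym.
  case: (eqVneq l l') => [->|neq] /=.
    by rewrite andbT; case: eqP; rewrite mxE ?eqxx.
  by rewrite andbF; case: eqP; rewrite mxE // (negPf neq).
rewrite mxE (bigD1 i) //= cellE eqxx andbT big1 ?addr0 => [|j neq].
  by case: ifP; rewrite ?mul1r ?mul0r.
by rewrite cellE [i == j]eq_sym (negPf neq) andbF mul0r.
Qed.

(** Let the algebra act on the component of [B] with entries in the group
    algebra of [gT], the weight of [g] being [g] itself.  Reading the coefficient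
    of [g] in the entry from [B] to [g^-1 *: B] detects exactly the arrow
    (B, g).  The matrices have size at most [m], so idempotents repeated more
    than [m] times act as zero. *)
Lemma dual_thin_functional m c : abelian [set: gT] ->
    [&& 1%g \in c.1, c.2 \in c.1 & (#|component c.1| <= m)%N] ->
  exists2 l : KP -> K, thin_functional m l
    & forall c', l (matrix_cell c') = (c == c')%:R.
Proof.
case: c => B g /= cGG /and3P[B1 Bg le_m].
have [n [D [next [def_n D_inj D1 nextE D_surj]]]] := component_enum B1.
pose z := @ga_gen K gT cGG.
have zM : forall x y, z (x * y)%g = z x * z y by exact: ga_genM.
have z1 : z 1%g = 1 by [].
pose V : gT -> scalar_restriction (@ga_cst K gT cGG) 'M[group_alg K cGG]_n.+1 :=
  vertex_mx z D next.
have repV : partial_rep V by exact: vertex_mx_rep.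
have [phi phiE _] := par_alg_universal repV.
have [i0 defi] : exists i, D i = B.
  by apply: D_surj; apply/imsetP; exists 1%g; rewrite // invg1 mul1g.
have [k0 defk] : exists k, D k = (g^-1 *: B)%g.
  by apply: D_surj; apply/imsetP; exists g.
pose l u := (phi u : 'M[group_alg K cGG]_n.+1) i0 k0 g.
exists l => [|[B' h]].
  split=> [a u v|a p b /(repeated_idem_morph phi)[pp [x [y xy]]]].
    rewrite /l linearP.
    rewrite [(_ + _ : 'M_ _) _ _]mxE ffunE; congr (_ + _).
    change ((ga_cst cGG a *: (phi u : 'M[group_alg K cGG]_n.+1)) i0 k0 g
      = a * l u).
    by rewrite mxE ga_cstM.
  rewrite /l !rmorphM /=.
  have -> : phi p = 0.
    by apply: (@repeated_idem_mx0 _ n.+1 m.+1 (phi p) x y); rewrite ?ltnS ?def_n.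
  by rewrite mulr0 mul0r mxE ffunE.
rewrite /l /matrix_cell rmorphM /= phiE.
have -> : phi (cell gen B') = cell (vertex_mx z D next) B'.
  rewrite /cell rmorph_prod; apply: eq_bigr => x _; rewrite /cell_factor.
  by case: ifP => _; rewrite ?rmorphB ?rmorph1 rmorphM /= !phiE.
rewrite (cell_vertex_mx z1 zM D_inj D1 nextE) xpair_eqE defi.
case: eqP => _ /=; last by rewrite ffunE.
rewrite mxE defi; case: (eqVneq g h) => [<-|neq_gh].
  have -> : k0 == next g i0 by apply/eqP/D_inj; rewrite nextE ?defi.
  by rewrite Bg /= ffunE eqxx.
by case: ifP => _; rewrite ffunE // (negPf neq_gh).
Qed.

End ComponentFunctionals.

(** The dual functionals of the left algebra, transported along the
    isomorphism, are determined by the arrows of the right one. *)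
Lemma leq_cell_count (K : idomainType) (gT rT : finGroupType) m :
    abelian [set: gT] ->
    (exists f : {lrmorphism par_alg K gT -> par_alg K rT}, bijective f) ->
  cell_count gT m <= cell_count rT m.
Proof.
move=> cGG [f bij_f].
pose inX (aT : finGroupType) (c : {set aT} * aT) :=
  [&& 1%g \in c.1, c.2 \in c.1 & #|component c.1| <= m].
have /fin_all_exists2[d thin_d dE] (x : {c | inX gT c}) :
    exists2 l : par_alg K gT -> K, thin_functional m l
      & forall c', l (matrix_cell K c') = (val x == c')%:R%R.
  exact: dual_thin_functional cGG (valP x).
have := leq_card_thin (a := fun x : {c | inX gT c} => matrix_cell K (val x))
  (b := fun y : {c | inX rT c} => matrix_cell K (val y)) bij_f thin_d.
rewrite !card_sig /cell_count !cardsE; apply.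
  by move=> x x'; rewrite dE (inj_eq val_inj).
move=> l thin_l l0; apply: thin_functional_eq0 thin_l _ => c Xc.
exact: (l0 (exist _ c Xc)).
Qed.

Theorem corollary4p5 (K : idomainType) (G H : finGroupType) :
  [pchar K]%R =i pred0 ->
  abelian [set: G] -> abelian [set: H] ->
  (exists f : {lrmorphism par_alg K G -> par_alg K H}, bijective f) ->
  [set: G] \isog [set: H].
Proof.
move=> _ cG cH isoGH; apply: isog_level_count => // -[|m] // _.
have eq_cell k : cell_count G k = cell_count H k.
  apply/eqP; rewrite eqn_leq (leq_cell_count k cG isoGH).
  apply: (@leq_cell_count K) => //.
  have [f /inverse_lrmorphism[g fK gK]] := isoGH.
  by exists g; exists f.
by have /eqP := eq_cell m.+1; rewrite !cell_countS eq_cell eqn_add2l => /eqP.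
Qed.
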